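(* Let $F_n$ be the free group of finite rank $n$, let $G \simeq F_n/K$ with canonical epimorphism $\pi: F_n \rightarrow G$. Let $\{K_ig_i\}_{i=1}^{s}$ be a coset partition of $G$ with $K_i<G$ of finite index $d_i>1$, $g_i \in G$, $1 \leq i \leq s$. Let $H_i=\pi^{-1}(K_i)$ and let $\alpha_i\in F_n$ be a preimage of $g_i$ under $\pi$. Then $\{H_i\alpha_i\}_{i=1}^{s}$ is a coset partition of $F_n$ with $H_i<F_n$ of index $d_i$. Furthermore, if $\{H_i\alpha_i\}_{i=1}^{s}$ satisfies one of the following conditions (where for (1) and (2) the indexing is such that $d_1\le\dots\le d_s$), then the coset partition $\{K_ig_i\}_{i=1}^{s}$ has multiplicity: (1) there exists a $d_s$-cycle in the transition group $T_s$ of $H_s$; (2) with $k=\max\{o_{max}(w)\mid w\in F_n\}$, $p$ the smallest prime dividing $k$, some $u\in F_n$ with $o_{max}(u)=k$, and $\#=|\{1\le i\le s\mid o_{*i}(u)=k\}|\ge 2$, one of the following holds: (a) $s\ge 3$ and $k>d_{s-2}$; (b) $s\ge 4$, $k>d_{s-3}$ and $p\ge 3$; (c) $s\ge 4$, $k>d_{s-3}$, $p=2$, and ($\#=2$ or $\#\ge 4$); (d) for some integer $4\le r\le s-1$, $k>d_{s-r}$ and ($p\ge r$, or $\#=p$, or $\#\ge r+1$); (3) there exist $1\le j,k\le s$ such that $\bigcap_{i=1}^{s}\alpha_i^{-1}H_i\alpha_i \subsetneqq \bigcap_{i\neq j,k}\alpha_i^{-1}H_i\alpha_i$, or such that $\operatorname{lcm}(d_j,d_k)$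 does not divide the index $[F_n: \bigcap_{i\neq j,k}\alpha_i^{-1}H_i\alpha_i]$.
   Context: A coset partition of a group $G$ is a finite family $\{K_ig_i\}_{i=1}^{s}$ of right cosets of subgroups $K_i\le G$ ($g_i\in G$) that are pairwise disjoint and whose union is $G$; here all subgroups have finite index $d_i$. It has multiplicity if $d_i=d_j$ for some $i\ne j$. For $H<F_n$ of finite index $d$, the transition group of $H$ is the image of $F_n$ in the symmetric group on the $d$ right cosets of $H$ under right multiplication; a $d$-cycle in it is a permutation that is a single cycle of length $d$. For $w\in F_n$, $o_{*i}(w)$ is the least natural number $m\ge1$ with $w^m\in\alpha_i^{-1}H_i\alpha_i$, and $o_{max}(w)=\max_{1\le i\le s}o_{*i}(w)$. Intersections $\bigcap_{i\ne j,k}$ are over all $1\le i\le s$ with $i\neq j$, $i\neq k$ (an empty intersection being $F_n$). *)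

(* Defs.v *)
From HB Require Import structures.
From mathcomp Require Import all_boot.
From mathcomp Require Import boolp classical_sets functions cardinality.

Set Implicit Arguments.
Unset Strict Implicit.
Unset Printing Implicit Defensive.

Local Open Scope classical_set_scope.
Local Open Scope group_scope.

(* [F] is free of rank [n], with basis [x]. *)
Definition free_basis (n : nat) (F : groupType) (x : 'I_n -> F) : Prop :=
  forall (G : groupType) (f : 'I_n -> G),
  exists phi : {multiplicative F -> G},
    (forall i, phi (x i) = f i) /\
    (forall psi : {multiplicative F -> G},
       (forall i, psi (x i) = f i) -> psi =1 phi).

Definition subgroup (G : groupType) (H : set G) : Prop := group_closed (mem H).

Definition right_coset (G : groupType) (H : set G) (a : G) : set G :=
  [set h * a | h in H].

Definition right_cosets (G : groupType) (H : set G) : set (set G) :=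
  range (right_coset H).

Definition has_index (G : groupType) (H : set G) (d : nat) : Prop :=
  card_eq (right_cosets H) `I_d.

Definition coset_partition (G : groupType) (s : nat)
    (K : 'I_s -> set G) (g : 'I_s -> G) : Prop :=
  [/\ forall i, subgroup (K i),
      trivIset setT (fun i => right_coset (K i) (g i))
    & \bigcup_i right_coset (K i) (g i) = setT].

(* [d i] is meant to be the index of the [i]-th subgroup. *)
Definition has_multiplicity (s : nat) (d : 'I_s -> nat) : Prop :=
  exists i j, i != j /\ d i = d j.

Lemma right_cosetsM (G : groupType) (H : set G) (w : G) (A : set G) :
  right_cosets H A -> right_cosets H [set a * w | a in A].
Proof.
case=> b _ <-; exists (b * w) => //; apply/seteqP; split=> y /=.
  by case=> h Hh <-; exists (h * b); [exists h | rewrite mulgA].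
by case=> _ [h Hh <-] <-; exists h => //; rewrite mulgA.
Qed.

Definition transition (G : groupType) (H : set G) (w : G)
    (A : right_cosets H) : right_cosets H :=
  exist _ [set a * w | a in val A] (mem_set (right_cosetsM w (set_valP A))).

Definition transition_group (G : groupType) (H : set G) :
    set (right_cosets H -> right_cosets H) :=
  range (@transition G H).
Arguments transition_group {G} H.

Definition is_cycle (T : Type) (d : nat) (f : T -> T) : Prop :=
  exists x : T,
    [/\ forall i j, (i < d)%N -> (j < d)%N -> iter i f x = iter j f x -> i = j,
        iter d f x = x
      & forall y, (forall i, y <> iter i f x) -> f y = y].

(* [h ^ a] is the conjugate a^-1 * h * a, so this is a^-1 H a. *)
Definition conj_set (G : groupType) (H : set G) (a : G) : set G :=
  [set h ^ a | h in H].

(* The default value 0 is never reached when [A] has finite index. *)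
Definition least_power_in (G : groupType) (A : set G) (w : G) : nat :=
  xget 0%N [set m : nat | [/\ (0 < m)%N, A (w ^+ m)
    & forall m', (0 < m')%N -> A (w ^+ m') -> (m <= m')%N]].

Definition o_star (G : groupType) (s : nat) (H : 'I_s -> set G)
    (alpha : 'I_s -> G) (i : 'I_s) (w : G) : nat :=
  least_power_in (conj_set (H i) (alpha i)) w.

Definition o_max (G : groupType) (s : nat) (H : 'I_s -> set G)
    (alpha : 'I_s -> G) (w : G) : nat :=
  \max_(i < s) o_star H alpha i w.

(* Ordinals count from 0: the [j]-th index d_j, 1 <= j <= s, is [d i] with
   [i.+1 = j]. *)
Definition d_lt (s : nat) (d : 'I_s -> nat) (j k : nat) : Prop :=
  exists i : 'I_s, i.+1 = j /\ (d i < k)%N.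

Definition nondecreasing_indices (s : nat) (d : 'I_s -> nat) : Prop :=
  forall i j : 'I_s, (i <= j)%N -> (d i <= d j)%N.

Definition cycle_condition (G : groupType) (s : nat) (H : 'I_s -> set G)
    (d : 'I_s -> nat) : Prop :=
  nondecreasing_indices d /\
  exists l : 'I_s, l.+1 = s /\
    exists f, transition_group (H l) f /\ is_cycle (d l) f.

(* The first clause says that k is the maximum of o_max over the whole group,
   attained at u. *)
Definition order_condition (G : groupType) (s : nat) (H : 'I_s -> set G)
    (alpha : 'I_s -> G) (d : 'I_s -> nat) : Prop :=
  nondecreasing_indices d /\
  exists (k p : nat) (u : G),
    let c := #|[pred i : 'I_s | o_star H alpha i u == k]| in
    [/\ (forall w, (o_max H alpha w <= k)%N) /\ o_max H alpha u = k,
        [/\ prime p, (p %| k)%N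
          & forall q, prime q -> (q %| k)%N -> (p <= q)%N],
        (2 <= c)%N
      & [\/ (3 <= s)%N /\ d_lt d (s - 2) k,
            [/\ (4 <= s)%N, d_lt d (s - 3) k & (3 <= p)%N],
            [/\ (4 <= s)%N, d_lt d (s - 3) k, p = 2
              & c = 2 \/ (4 <= c)%N]
          | exists r : nat, [/\ (4 <= r)%N, (r <= s - 1)%N, d_lt d (s - r) k
              & [\/ (r <= p)%N, c = p | (r + 1 <= c)%N]]]].

Definition intersection_condition (G : groupType) (s : nat)
    (H : 'I_s -> set G) (alpha : 'I_s -> G) (d : 'I_s -> nat) : Prop :=
  exists j k : 'I_s,
    let A i := conj_set (H i) (alpha i) in
    let B := \bigcap_(i in [set i | i != j /\ i != k]) A i in
    (\bigcap_i A i `<` B) \/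
    (exists m, has_index B m /\ ~~ (lcmn (d j) (d k) %| m)%N).

(* Main.v *)
Require Import Defs.
From HB Require Import structures.
From mathcomp Require Import all_boot all_fingroup all_algebra.
From mathcomp Require Import algC cyclotomic finmap.
From mathcomp Require Import boolp classical_sets functions cardinality.

Set Implicit Arguments.
Unset Strict Implicit.
Unset Printing Implicit Defensive.

Import GRing.Theory Num.Theory.

Local Open Scope classical_set_scope.
Local Open Scope group_scope.

(* Fix u and f in F.  The exponents x with f u^x in H_i alpha_i form a class
   modulo o_i = o_{*i}(u) or the empty set, so the partition of F induces a
   partition of nat into classes modulo the o_i.  Summing z^(m x) over a common
   period, for z a primitive root of unity of order M, the largest modulus, and
   m prime to M, only the classes modulo M survive.  Since every 0 < m < p is
   prime to M, p being the least prime factor of M, a polynomial without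
   constant term and of degree < p cannot vanish at all but one of the z^(a_i):
   at least p classes have modulus M.

   (1) Here d_s is the largest modulus, so o_i = d_s for some other i, and
   o_i <= d_i <= d_s.
   (2) The hypotheses force the number c of indices with o_i(u) = k to be at
   most p, so each coset f <u> meets all of these cells or none of them.
   Counting the cells H_i alpha_i u^t, t < k, in a finite quotient of F gives
   equal indices.
   (3) An element w fixing all cells but the j-th and k-th must swap these two,
   whence H_j = H_k; if there is no such w then the index in the second
   alternative is divisible by d_j and d_k. *)

(** * Partitions of nat into residue classes *)

(** By induction on [n]: one further shift drops the term [g n] and gains the equal term
    [g (L + n)]. *)
Lemma sum_shift (V : zmodType) (g : nat -> V) (L n : nat) :
  (forall x, g (x + L)%N = g x) -> (\sum_(x < L) g (x + n)%N = \sum_(x < L) g x)%R.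
Proof.
move=> gL; elim: n => [|n <-]; first by apply: eq_bigr => x _; rewrite addn0.
apply: (@addrI _ (g n)); transitivity (\sum_(x < L.+1) g (x + n)%N)%R.
  rewrite big_ord_recl /= add0n; congr (_ + _)%R.
  by apply: eq_bigr => x _; rewrite addSnnS.
by rewrite big_ord_recr /= addnC gL addrC.
Qed.

(** Shifting by [n] multiplies the sum by [c], but over a full period a shift changes nothing. *)
Lemma sum_twist0 (C : fieldType) (g : nat -> C) (L n : nat) (c : C) :
  (forall x, g (x + L)%N = g x) -> (forall x, g (x + n)%N = c * g x)%R ->
  (c != 1)%R -> (\sum_(x < L) g x = 0)%R.
Proof.
move=> gL gn c1; have := @sum_shift _ g L n gL; under eq_bigr do rewrite gn.
rewrite -mulr_sumr -[X in _ = X -> _]mul1r => /eqP; rewrite -subr_eq0 -mulrBl mulf_eq0.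
by rewrite subr_eq0 (negPf c1) => /eqP.
Qed.

(** Each [phi i] is empty or a full residue class modulo [o i]. If fewer than [p] classes of modulus
    [M] were nonempty, a polynomial of degree below [p] would isolate one of them in the exponential
    sums. *)
Lemma maximal_modulus_repeats (I : finType) (o : I -> nat) (phi : I -> pred nat)
    (M p : nat) :
  (forall i, 0 < o i <= M)%N ->
  (forall x, exists i, phi i x) ->
  (forall i j x, phi i x -> phi j x -> i = j) ->
  (forall i x y, phi i x -> phi i y = (x == y %[mod o i])) ->
  (exists i x, o i = M /\ phi i x) -> (1 < M)%N ->
  (forall q, prime q -> q %| M -> p <= q)%N ->
  (p <= #|[pred i | (o i == M) && [exists x : 'I_M, phi i x]]|)%N.
Proof.
move=> oM cover disj per [i0 [x0 [oi0 phi0]]] M1 p_min.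
set A := [pred i | _]; rewrite leqNgt; apply/negP => ltAp.
have M0 : (0 < M)%N by exact: ltnW.
have [z pz] := C_prim_root_exists M0.
pose L := (\prod_i o i)%N.
have oL i : (o i %| L)%N by rewrite /L (bigD1 i) //= dvdn_mulr.
have ML : (M %| L)%N by rewrite -oi0.
have L0 : (0 < L)%N by apply: prodn_gt0 => i; case/andP: (oM i).
have perD i x n : (o i %| n)%N -> phi i (x + n)%N = phi i x.
  move=> /dvdnP[q ->]; apply/idP/idP => H; rewrite (per _ _ _ H) ?modnMDl;
  by rewrite addnC modnMDl.
(* A common prime factor of [M] and [m] would be at least [p], yet at most [m < p]. *)
have copM m : (0 < m < p)%N -> coprime M m.
  case/andP=> m0 mp; rewrite /coprime; apply: contraTT mp => g1; rewrite -leqNgt.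
  have pp : prime (pdiv (gcdn M m)).
    by apply: pdiv_prime; rewrite ltn_neqAle eq_sym g1 gcdn_gt0 M0.
  apply: leq_trans (p_min _ pp _) (dvdn_leq m0 _);
    by apply: dvdn_trans (pdiv_dvd _) _; rewrite ?dvdn_gcdl ?dvdn_gcdr.
pose S i m := (\sum_(x < L) (phi i x)%:R * z ^+ (x * m))%R.
have zL n x m : (M %| n)%N -> (z ^+ ((x + n) * m) = z ^+ (x * m))%R.
  move=> Mn; apply/eqP; rewrite (eq_prim_root_expr pz) mulnDl addnC.
  by case/dvdnP: Mn => q ->; rewrite mulnAC modnMDl.
(* A class of modulus [M] outside [A] is empty. If [o i < M], shifting by [o i] preserves the class
   and multiplies the summand by [z ^+ (o i * m)], which is not 1 because [m] is prime to [M]. *)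
have S0 i m : (0 < m < p)%N -> i \notin A -> S i m = 0%R.
  move=> mp; rewrite inE; have [oiM /existsPn nphi|oiM _] := eqVneq (o i) M.
    apply: big1 => x _; case: (boolP (phi i x)) => [H|_]; last by rewrite mul0r.
    have := nphi (Ordinal (ltn_pmod x M0)).
    by rewrite /= (per _ _ _ H) oiM modn_mod eqxx.
  apply: (@sum_twist0 _ (fun x => (phi i x)%:R * z ^+ (x * m)) L (o i)
    (z ^+ (o i * m)))%R.
  - by move=> x; rewrite perD // zL.
  - by move=> x; rewrite perD // mulnDl exprD mulrA mulrC.
  - rewrite -(expr0 z) (eq_prim_root_expr pz) mod0n; apply/negP => Mo.
    have {Mo} : (M %| o i * m)%N by exact: Mo.
    rewrite Gauss_dvdl ?copM // => /dvdn_leq.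
    case/andP: (oM i) => o0 o1 /(_ o0) o2.
    by case/eqP: oiM; apply/eqP; rewrite eqn_leq o1.
have SA m : (0 < m < p)%N -> (\sum_(i in A) S i m = 0)%R.
  move=> mp; have -> : (\sum_(i in A) S i m = \sum_i S i m)%R.
    rewrite [RHS](bigID (mem A)) /= [X in _ = (_ + X)%R]big1 ?addr0 // => i.
    exact: S0.
  (* Each [x] lies in exactly one class, so only the sum of all [z ^+ (x * m)] over a period
     remains. *)
  rewrite exchange_big /=.
  have E x : (\sum_i (phi i x)%:R * z ^+ (x * m) = z ^+ (x * m))%R.
    have [i phii] := cover x; rewrite (bigD1 i) //= phii mul1r big1 ?addr0 // => j ji.
    case: (boolP (phi j x)) => [phij|]; last by rewrite mul0r.
    by rewrite (disj _ _ _ phii phij) eqxx in ji.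
  under eq_bigr do rewrite E.
  apply: (@sum_twist0 _ (fun x => z ^+ (x * m)) L 1 (z ^+ m))%R.
  - by move=> x; rewrite zL.
  - by move=> x; rewrite mulnDl exprD mul1n mulrC.
  - rewrite -(expr0 z) (eq_prim_root_expr pz) mod0n; apply/negP => Mo.
    have {Mo} : (M %| m)%N by exact: Mo.
    move=> /gcdn_idPl; move: (copM m mp); rewrite /coprime => /eqP -> EM.
    by rewrite -EM in M1.
(* By linearity [SA] extends from the monomials of degree between 1 and [p - 1] to their
   combinations. *)
have SP (q : {poly algC}) : (size q <= p)%N -> (q`_0 = 0)%R ->
    (\sum_(i in A) \sum_(x < L) (phi i x)%:R * q.[z ^+ x] = 0)%R.
  move=> sq q0.
  transitivity (\sum_(m < size q) q`_m * \sum_(i in A) S i m)%R; last first.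
    apply: big1 => -[[|m] lm] _ /=; first by rewrite q0 mul0r.
    by rewrite SA ?mulr0 //=; apply: leq_trans lm sq.
  under [RHS]eq_bigr do rewrite mulr_sumr.
  rewrite [RHS]exchange_big /=; apply: eq_bigr => i _.
  under [RHS]eq_bigr do rewrite /S mulr_sumr.
  rewrite [RHS]exchange_big /=; apply: eq_bigr => x _.
  rewrite horner_coef mulr_sumr; apply: eq_bigr => m _.
  by rewrite exprM mulrCA.
have aP i : exists x, (i \in A) ==> phi i x.
  case: (boolP (i \in A)) => [|_]; last by exists 0%N.
  by rewrite inE => /andP[_ /existsP[x Hx]]; exists x; apply/implyP.
pose a i := xchoose (aP i).
have aA i : i \in A -> phi i (a i) by apply/implyP; exact: (xchooseP (aP i)).
(* q has no constant term and, among the z ^+ a j with j in A, vanishes at all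
   but z ^+ a i0. *)
pose q := ('X * \prod_(j in A | j != i0) ('X - (z ^+ a j)%:P))%R : {poly algC}.
have zphi i x y : i \in A -> phi i x -> (z ^+ x == z ^+ y)%R = phi i y.
  by rewrite inE (eq_prim_root_expr pz) => /andP[/eqP <- _] /per ->.
have phi0M : phi i0 (x0 %% M)%N.
  by rewrite (per _ _ _ phi0) oi0 modn_mod.
have i0A : i0 \in A.
  rewrite inE oi0 eqxx; apply/existsP.
  by exists (Ordinal (ltn_pmod x0 M0)); exact: phi0M.
have/SP : (size q <= p)%N.
  (* The factor ['X] replaces the missing root at [i0], so the degree of [q] is [#|A|], which is
     below [p]. *)
  rewrite /q mulrC size_mulX ?monic_neq0 ?monic_prod_XsubC //.
  rewrite -big_filter size_prod_XsubC -?cardE.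
  by apply: leq_trans ltAp; rewrite [X in _ < X.+1](cardD1x i0A).
have -> : (q`_0 = 0)%R by rewrite coefXM.
move/(_ erefl)/eqP; apply/negP.
have q0 x : phi i0 x -> q.[z ^+ x]%R = q.[z ^+ x0]%R.
  by rewrite -(zphi _ _ _ i0A phi0) => /eqP ->.
have qv : q.[z ^+ x0]%R != 0%R.
  rewrite /q hornerM hornerX mulf_neq0 ?expf_neq0 ?(prim_root_eq0 pz) -?lt0n //.
  rewrite horner_prod; apply/prodf_neq0 => j /andP[jA ji].
  rewrite hornerXsubC subr_eq0 (zphi i0) //; apply: contra ji => H.
  by rewrite (disj _ _ _ (aA j jA) H).
rewrite (bigD1 i0) //= [X in (_ + X)%R]big1 ?addr0; last first.
  move=> j jA; apply: big1 => x _.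
  case: (boolP (phi j x)) => [H|_]; last by rewrite mul0r.
  rewrite mul1r /q hornerM horner_prod (bigD1 j) //= hornerXsubC.
  have/eqP -> : (z ^+ x == z ^+ a j)%R.
    by case/andP: jA => jA _; rewrite (zphi j) ?aA.
  by rewrite subrr mul0r mulr0.
(* [q] is constant on the class of [i0], so what remains is its nonzero value times the number of
   members below [L], which is positive and nonzero in characteristic 0. *)
have -> : (\sum_(x < L) (phi i0 x)%:R * q.[z ^+ x] =
    (\sum_(x < L) (phi i0 x))%:R * q.[z ^+ x0])%R.
  rewrite natr_sum mulr_suml; apply: eq_bigr => x _.
  by case: (boolP (phi i0 x)) => [/q0 ->|]; rewrite ?mul0r.
rewrite mulf_neq0 // pnatr_eq0 -lt0n.
have lt0 : (x0 %% M < L)%N by apply: leq_trans (ltn_pmod _ M0) (dvdn_leq L0 ML).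
by rewrite (bigD1 (Ordinal lt0)) //= phi0M.
Qed.

(** * Subgroups of finite index *)

Section Multiplicative.
Variables (G H : groupType) (f : {multiplicative G -> H}).

Lemma multiplicative1 : f 1 = 1.
Proof. by apply: (mulgI (f 1)); rewrite -gmulfM !mulg1. Qed.

Lemma multiplicativeV : {morph f : x / x^-1}.
Proof. by move=> x; apply: (mulgI (f x)); rewrite -gmulfM !mulgV multiplicative1. Qed.

Lemma multiplicativeX n : {morph f : x / x ^+ n}.
Proof.
by elim: n => [|n IHn] x; [exact: multiplicative1|rewrite !expgS gmulfM IHn].
Qed.

End Multiplicative.

Section Subgroups.
Variables (G : groupType) (H : set G).
Hypothesis subH : subgroup H.

Lemma subgroup1 : H 1.
Proof. by case: subH => + _; rewrite inE. Qed.

Lemma subgroupF x y : H x -> H y -> H (x * y^-1).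
Proof. by case: subH => _ SF Hx Hy; have := SF x y; rewrite !inE; apply. Qed.

Lemma subgroupV x : H x -> H x^-1.
Proof. by move=> Hx; rewrite -div1g; apply: subgroupF => //; exact: subgroup1. Qed.

Lemma subgroupM x y : H x -> H y -> H (x * y).
Proof. by move=> Hx Hy; rewrite -[y]invgK; apply/subgroupF/subgroupV. Qed.

Lemma right_cosetP a y : right_coset H a y <-> H (y * a^-1).
Proof.
split=> [[h Hh <-]|Hya]; first by rewrite mulgK.
by exists (y * a^-1) => //; rewrite mulgVK.
Qed.

Lemma eq_right_coset a b : right_coset H a = right_coset H b <-> H (a * b^-1).
Proof.
split=> [ab|Hab].
  apply/right_cosetP; rewrite -ab; apply/right_cosetP; rewrite mulgV.
  exact: subgroup1.
apply/seteqP; split=> y /right_cosetP Hy; apply/right_cosetP.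
  by rewrite -(divgKA a); exact: subgroupM.
by rewrite -(divgKA b) -(invgF a b); apply/subgroupM/subgroupV.
Qed.

End Subgroups.

Lemma subgroup_intro (G : groupType) (H : set G) :
  H 1 -> (forall x y, H x -> H y -> H (x * y^-1)) -> subgroup H.
Proof. by move=> H1 HF; split=> [|x y]; rewrite !inE //; exact: HF. Qed.

Lemma subgroupT (G : groupType) : subgroup [set: G].
Proof. exact: subgroup_intro. Qed.

(** * Finite quotients *)

Lemma image_group (F : groupType) (gT : finGroupType)
    (rho : {multiplicative F -> gT}) (A : set F) : subgroup A ->
  exists Q : {group gT}, forall y, y \in Q <-> exists2 w, A w & rho w = y.
Proof.
move=> subA; pose S := [set y | `[< exists2 w, A w & rho w = y >]]%SET.
have SP y : reflect (exists2 w, A w & rho w = y) (y \in S).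
  by rewrite finset.in_set; exact: asboolP.
have gS : group_set S.
  apply/group_setP; split.
    by apply/SP; exists 1; [exact: subgroup1|exact: multiplicative1].
  move=> _ _ /SP[u Au <-] /SP[v Av <-]; apply/SP; exists (u * v).
    exact: subgroupM.
  exact: gmulfM.
by exists (Group gS) => y; split=> [/SP|?]; last apply/SP.
Qed.

(** [F] acts by right multiplication on the union of the finitely many coset spaces. Two elements
    that move the point [H i] alike lie in one right coset of [H i]. *)
Lemma coset_action (F : groupType) (I : finType) (H : I -> set F) :
  (forall i, subgroup (H i)) -> (forall i, finite_set (right_cosets (H i))) ->
  exists (T : finType) (rho : {multiplicative F -> {perm T}}),
    forall i w w', rho w = rho w' -> H i (w * w'^-1).
Proof.
move=> subH finH.
pose Om := \bigcup_i right_cosets (H i).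
have finO : finite_set Om by apply: bigcup_finite => // ; exact: finite_finset.
pose T : finType := fset_set Om.
have OmM w A : Om A -> Om [set a * w | a in A].
  by case=> i _ /right_cosetsM; exists i.
have TP (c : T) : Om (val c) by have := valP c; rewrite in_fset_set // inE.
(* The default [c] of [insubd] is never taken, as [Om] is closed under translation. *)
pose act w (c : T) : T := insubd c [set a * w | a in val c].
have actE w c : val (act w c) = [set a * w | a in val c].
  by rewrite insubdK // in_fset_set // inE; exact/OmM/TP.
have actM w w' c : act (w * w') c = act w' (act w c).
  apply: val_inj; rewrite !actE; apply/seteqP; split=> y /=.
    by case=> a Aa <-; exists (a * w); [exists a|rewrite mulgA].
  by case=> _ [a Aa <-] <-; exists a => //; rewrite mulgA.
have act1 c : act 1 c = c.
  apply: val_inj; rewrite actE; apply/seteqP; split=> y /=.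
    by case=> a Aa <-; rewrite mulg1.
  by move=> Ay; exists y => //; rewrite mulg1.
have act_inj w : injective (act w).
  by apply: (can_inj (g := act w^-1)) => c; rewrite -actM mulgV act1.
pose rho w := perm (act_inj w).
have rhoM : {morph rho : x y / x * y}.
  by move=> x y; apply/permP => c; rewrite permM !permE actM.
exists T, (HB.pack_for {multiplicative F -> {perm T}} rho
  (isMultiplicative.Build _ _ _ rhoM)).
move=> i w w' /= /permP ww'; have Hi : H i \in fset_set Om.
  rewrite in_fset_set // inE; exists i => //; exists 1 => //.
  by apply/seteqP; split=> y; rewrite right_cosetP // invg1 mulg1.
have := ww' (FSetSub Hi); rewrite !permE => /(congr1 val); rewrite !actE /=.
by move/(eq_right_coset (subH i)).
Qed.

(** Cutting the permutation group down to the image of the action gives surjectivity; the kernel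
    lies in every [H i], so each [H i] is a full preimage. Orders and indices can then be computed
    in a finite group. *)
Lemma finite_quotient (F : groupType) (I : finType) (H : I -> set F) :
  (forall i, subgroup (H i)) -> (forall i, finite_set (right_cosets (H i))) ->
  exists (gT : finGroupType) (rho : {multiplicative F -> gT}) (Q : I -> {group gT}),
    range rho = setT /\ forall i, H i = rho @^-1` [set` Q i].
Proof.
move=> subH finH; have [T [rho rhoH]] := coset_action subH finH.
have [Gr GrP] := image_group rho (subgroupT F).
have rhoG w : rho w \in Gr by apply/GrP; exists w.
pose rho' w := subg Gr (rho w).
have rhoM : {morph rho' : x y / x * y}.
  by move=> x y; rewrite /rho' gmulfM subgM.
pose r := HB.pack_for {multiplicative F -> [subg Gr]} rho'
  (isMultiplicative.Build _ _ _ rhoM).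
have /choice[Q QP] i : exists Q : {group [subg Gr]},
    forall y, y \in Q <-> exists2 w, H i w & r w = y.
  exact: image_group.
exists (subg_of Gr), r, Q; split.
  apply/seteqP; split=> // y _; have /GrP[w _ wy] := subgP y.
  by exists w => //; apply: val_inj; rewrite /= subgK.
move=> i; apply/seteqP; split=> w /=; first by move=> Hw; apply/QP; exists w.
case/QP=> w' Hw' /(congr1 val); rewrite /= !subgK // => /esym/rhoH Hww.
by rewrite -(mulgVK w' w); apply: subgroupM.
Qed.

(** * Preimages under an epimorphism, and indices *)

Section Preimage.
Variables (F G : groupType) (pi : {multiplicative F -> G}).
Hypothesis pi_surj : range pi = setT.

Lemma right_coset_preimage (K : set G) a : subgroup K ->
  right_coset (pi @^-1` K) a = pi @^-1` right_coset K (pi a).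
Proof.
move=> subK; apply/seteqP; split=> y.
  by move/right_cosetP => Hy; apply/right_cosetP; rewrite -multiplicativeV -gmulfM.
by move/right_cosetP; rewrite -multiplicativeV -gmulfM => Hy; apply/right_cosetP.
Qed.

Lemma subgroup_preimage (K : set G) : subgroup K -> subgroup (pi @^-1` K).
Proof.
move=> subK; apply: subgroup_intro => [|x y];
  rewrite /= ?multiplicative1 ?gmulfM ?multiplicativeV.
  exact: subgroup1.
exact: subgroupF.
Qed.

Lemma card_cosets_preimage (K : set G) : subgroup K ->
  card_eq (right_cosets (pi @^-1` K)) (right_cosets K).
Proof.
move=> subK; have -> : right_cosets (pi @^-1` K) = [set pi @^-1` A | A in right_cosets K].
  apply/seteqP; split=> A /=.
    by case=> a _ <-; rewrite right_coset_preimage //; eexists; [exists (pi a)|].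
  case=> _ [b _ <-] <-; have [a _ <-] : range pi b by rewrite pi_surj.
  by exists a => //; rewrite right_coset_preimage.
apply: inj_card_eq => A B _ _ AB; apply/seteqP; split=> y;
  (have [x _ <-] : range pi y by rewrite pi_surj);
  by move: AB => /(congr1 (@^~ x)) /= ->.
Qed.

End Preimage.

Lemma subgroup_group (gT : finGroupType) (Q : {group gT}) : subgroup [set` Q].
Proof.
by apply: subgroup_intro => [|x y] /= *; [exact: group1|rewrite groupM ?groupV].
Qed.

Lemma has_index_group (gT : finGroupType) (Q : {group gT}) :
  has_index [set` Q] #|[set: gT]%SET : Q|.
Proof.
apply: card_esym; apply: card_eq_trans (card_II) _.
have -> : right_cosets [set` Q] =
    [set [set` enum_val k] | k in [set: 'I_#|rcosets Q [set: gT]%SET|]].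
  have E x : right_coset [set` Q] x = [set` Q :* x]%g.
    apply/seteqP; split=> y /=; first by move/right_cosetP; rewrite mem_rcoset.
    by move=> Hy; apply/right_cosetP; rewrite /= -mem_rcoset.
  apply/seteqP; split=> A /=.
    case=> x _ <-; have Rx : Q :* x \in rcosets Q [set: gT]%SET.
      by apply/rcosetsP; exists x.
    by exists (enum_rank_in Rx (Q :* x)) => //; rewrite enum_rankK_in // E.
  case=> k _ <-; have /rcosetsP[x _ ->] := enum_valP k; by exists x.
apply: card_esym; apply: inj_card_eq => k l _ _ kl; apply: enum_val_inj.
by apply/setP => y; move: kl => /(congr1 (@^~ y)) /= /is_true_inj.
Qed.

Lemma has_index_inj (G : groupType) (H : set G) d e :
  has_index H d -> has_index H e -> d = e.
Proof. by move=> /card_esym Hd /(card_eq_trans Hd)/card_eq_II. Qed.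

Lemma has_index_preimage (F G : groupType) (pi : {multiplicative F -> G}) (K : set G) d :
  range pi = setT -> subgroup K -> has_index K d -> has_index (pi @^-1` K) d.
Proof. by move=> ps subK; apply: card_eq_trans; exact: card_cosets_preimage. Qed.

Lemma has_index_quotient (F : groupType) (gT : finGroupType)
    (rho : {multiplicative F -> gT}) (Q : {group gT}) :
  range rho = setT -> has_index (rho @^-1` [set` Q]) #|[set: gT]%SET : Q|.
Proof.
move=> ps; apply: has_index_preimage ps _ _; first exact: subgroup_group.
exact: has_index_group.
Qed.

(** * Conjugates and powers of an element *)

Section ConjSet.
Variables (G : groupType) (H : set G) (a : G).

Lemma conj_setP x : conj_set H a x <-> H (a * x * a^-1).
Proof.
split=> [[h Hh <-]|Hx]; first by rewrite conjgE !mulgA mulgV mul1g mulgK.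
by exists (a * x * a^-1) => //; rewrite conjgE !mulgA mulVg mul1g mulgVK.
Qed.

Let conj_morph : {morph (fun x => a * x * a^-1) : x y / x * y}.
Proof. by move=> x y; rewrite !mulgA mulgVK. Qed.

(** With conjugation as an endomorphism, the conjugate subgroup is a preimage and inherits its
    properties from the lemmas on preimages. *)
Let conj_mult : {multiplicative G -> G} :=
  HB.pack_for {multiplicative G -> G} (fun x => a * x * a^-1)
    (isMultiplicative.Build _ _ _ conj_morph).

Let conj_setE : conj_set H a = conj_mult @^-1` H.
Proof. by apply/seteqP; split=> x /conj_setP. Qed.

Lemma subgroup_conj : subgroup H -> subgroup (conj_set H a).
Proof. by rewrite conj_setE; exact: subgroup_preimage. Qed.

Lemma has_index_conj d : subgroup H -> has_index H d -> has_index (conj_set H a) d.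
Proof.
rewrite conj_setE; apply: has_index_preimage; apply/seteqP; split=> // y _.
by exists (a^-1 * y * a) => //=; rewrite !mulgA mulgV mul1g mulgK.
Qed.

(** The conjugate by [a] is the stabilizer of the coset [H a] under right multiplication;
    [conj_right_coset] adds that moving a single point within the coset already implies stabilizing
    it. *)
Lemma right_coset_conj w y : subgroup H -> conj_set H a w ->
  right_coset H a (y * w) <-> right_coset H a y.
Proof.
move=> subH /conj_setP Hw; rewrite !right_cosetP.
have E : y * w * a^-1 = (y * a^-1) * (a * w * a^-1) by rewrite !mulgA mulgVK.
split=> Hy; last by rewrite E; exact: subgroupM.
by rewrite -(mulgK (a * w * a^-1) (y * a^-1)) -E; exact: subgroupF.
Qed.

Lemma conj_right_coset w y : subgroup H ->
  right_coset H a y -> right_coset H a (y * w) -> conj_set H a w.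
Proof.
move=> subH /right_cosetP Hy /right_cosetP Hyw; apply/conj_setP.
have -> : a * w * a^-1 = (y * a^-1)^-1 * (y * w * a^-1).
  by rewrite invgM invgK !mulgA mulgVK.
by apply: subgroupM => //; exact: subgroupV.
Qed.

(** For [x <= y] the two points differ by the factor [u ^+ (y - x)], so they share the coset exactly
    when this power stabilizes it. *)
Lemma right_coset_expg o u f x y : subgroup H ->
  (forall m, conj_set H a (u ^+ m) <-> o %| m) ->
  right_coset H a (f * u ^+ x) ->
  (right_coset H a (f * u ^+ y) <-> x = y %[mod o]).
Proof.
move=> subH Ho; wlog le_xy: x y / x <= y => [W|] Hx.
  have [/W|/ltnW yx] := leqP x y; first exact.
  split=> [Hy|/esym xy]; first by symmetry; apply/(W _ _ yx Hy).
  have Hxy : o %| x - y by rewrite -eqn_mod_dvd // xy.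
  by move: Hx; rewrite -(subnKC yx) expgnDr mulgA right_coset_conj //; apply/Ho.
have E : f * u ^+ y = f * u ^+ x * u ^+ (y - x) by rewrite -mulgA -expgnDr subnKC.
have -> : x = y %[mod o] <-> o %| y - x.
  by rewrite -eqn_mod_dvd //; split=> [->|/eqP].
rewrite -Ho E; split; first exact: conj_right_coset.
by move=> ?; apply/right_coset_conj.
Qed.

End ConjSet.

Lemma has_index_finite (G : groupType) (H : set G) d :
  has_index H d -> finite_set (right_cosets H).
Proof. by move=> Hd; apply/finite_setP; exists d. Qed.

(** Lagrange's theorem in a finite quotient of which both subgroups are preimages. *)
Lemma index_dvd (F : groupType) (A B : set F) m d :
  subgroup A -> subgroup B -> A `<=` B -> has_index A m -> has_index B d -> d %| m.
Proof.
move=> subA subB AB Am Bd.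
have [||gT [rho [Q [rho_surj HQ]]]] :=
  @finite_quotient F bool (fun b => if b then A else B).
- by case.
- by case; [exact: has_index_finite Am|exact: has_index_finite Bd].
have QAB : Q true \subset Q false.
  apply/fintype.subsetP => y; have [w _ <-] : range rho y by rewrite rho_surj.
  by have := HQ true; have := HQ false => /= BE AE; move: (AB w); rewrite AE BE.
have mE : m = #|[set: gT]%SET : Q true|.
  by apply: has_index_inj Am _; rewrite (HQ true); exact: has_index_quotient.
have dE : d = #|[set: gT]%SET : Q false|.
  by apply: has_index_inj Bd _; rewrite (HQ false); exact: has_index_quotient.
by rewrite mE dE -(Lagrange_index (finset.subsetT (Q false)) QAB) dvdn_mulr.
Qed.

(** Pigeonhole: among the [d.+1] cosets of the powers from 0 to [d] two coincide, so some positive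
    power at most [d] lies in [A] and the default of [xget] is not reached. Division with remainder
    gives the second claim. *)
Lemma least_power_inP (G : groupType) (A : set G) d w :
  subgroup A -> has_index A d ->
  0 < least_power_in A w <= d /\
  forall m, A (w ^+ m) <-> least_power_in A w %| m.
Proof.
move=> subA Ad.
have [m /andP[m0 md] Am] : exists2 m, 0 < m <= d & A (w ^+ m).
  apply: contrapT => nA; suff : d.+1 <= d by rewrite ltnn.
  rewrite -card_le_II -(card_le_eqr Ad).
  pose f x := right_coset A (w ^+ x).
  have f_inj : {in `I_d.+1 &, injective f}.
    suff W x y : x < y -> y < d.+1 -> f x <> f y.
      move=> x y; rewrite !inE /= => xd yd fxy.
      by have [/W|/W|//] := ltngtP x y; [move/(_ yd)|move/(_ xd)/nesym].
    move=> xy yd /esym /(eq_right_coset subA); rewrite -expgnFr 1?ltnW // => Axy.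
    apply: nA; exists (y - x) => //; rewrite subn_gt0 xy /=.
    by rewrite (leq_trans (leq_subr x y)).
  rewrite -(card_le_eql (inj_card_eq f_inj)); apply: subset_card_le.
  by move=> _ [x _ <-]; exists (w ^+ x).
pose P m := [/\ 0 < m, A (w ^+ m) & forall m', 0 < m' -> A (w ^+ m') -> m <= m'].
have ex : exists m, `[< 0 < m /\ A (w ^+ m) >] by exists m; apply/asboolP.
have Pmin : P (ex_minn ex).
  case: ex_minnP => n /asboolP[n0 An] nmin; split=> // m' m'0 Am'.
  by apply: nmin; apply/asboolP.
rewrite /least_power_in; set o := xget _ _.
have [o0 Ao omin] : P o by apply: xgetPex; exists (ex_minn ex).
split; first by rewrite o0 (leq_trans (omin _ m0 Am)).
have AX q : A (w ^+ (q * o)).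
  elim: q => [|q IHq]; first exact: subgroup1.
  by rewrite mulSn expgnDr; exact: subgroupM.
move=> n; split=> [An|/dvdnP[q ->]]; last exact: AX.
rewrite /dvdn -leqn0 leqNgt; apply/negP => r0.
have /omin : A (w ^+ (n %% o)).
  move: An; rewrite {1}(divn_eq n o) expgnDr => An.
  rewrite -(mulKg (w ^+ (n %/ o * o)) (w ^+ (n %% o))).
  by apply: subgroupM => //; exact: subgroupV.
by move/(_ r0); rewrite leqNgt ltn_pmod.
Qed.

(** Double count of the pairs [(z, t)] with [t < k] and [z * y ^+ t] in the coset: each [z] counted
    on the left has exactly one such [t], and each [t] allows a translate of [Q]. *)
Lemma card_cosets_orbits (gT : finGroupType) (Q : {group gT}) (b y : gT) k :
  0 < k -> (forall m, conj_set [set` Q] b (y ^+ m) <-> k %| m) ->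
  #|[pred z | `[< exists x, right_coset [set` Q] b (z * y ^+ x) >]]| = (k * #|Q|)%N.
Proof.
move=> k0 Hk; have sQ := subgroup_group Q.
pose e z (t : nat) := z * y ^+ t \in Q :* b.
have eP z t : reflect (right_coset [set` Q] b (z * y ^+ t)) (e z t).
  by rewrite /e mem_rcoset; apply: (iffP idP) => [?|/right_cosetP//]; exact/right_cosetP.
transitivity (\sum_z \sum_(t < k) e z t).
  rewrite -sum1_card big_mkcond; apply: eq_bigr => z _; rewrite inE.
  case: asboolP => [[x Hx]|nx].
    have Ht : e z (x %% k).
      by apply/eP/(right_coset_expg _ sQ Hk Hx); rewrite modn_mod.
    rewrite (bigD1 (Ordinal (ltn_pmod x k0))) //= Ht big1 ?addn0 // => t tx.
    apply/eqP; rewrite eqb0; apply: contra tx => /eP/(right_coset_expg _ sQ Hk Hx).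
    by rewrite -val_eqE /= (modn_small (ltn_ord t)) => ->.
  by rewrite big1 // => t _; case: eP => // Ht; case: nx; exists t.
rewrite exchange_big /= -[k in RHS]card_ord -sum_nat_const.
apply: eq_bigr => t _; rewrite -(card_rcoset Q (b * y ^- t)) -sum1_card big_mkcond /=.
rewrite [RHS]big_mkcond /=; apply: eq_bigr => z _.
rewrite /e !mem_rcoset invgM invgK mulgA.
by case: (_ \in _).
Qed.

(** If the same left cosets of the powers of [u] meet both cells, then in a finite quotient
    [card_cosets_orbits] counts one set in two ways, and the images of [H1] and [H2] have the same
    order. *)
Lemma eq_index_orbits (F : groupType) (H1 H2 : set F) d1 d2 (a1 a2 u : F) k :
  subgroup H1 -> subgroup H2 -> has_index H1 d1 -> has_index H2 d2 -> 0 < k ->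
  (forall m, conj_set H1 a1 (u ^+ m) <-> k %| m) ->
  (forall m, conj_set H2 a2 (u ^+ m) <-> k %| m) ->
  (forall f, (exists x, right_coset H1 a1 (f * u ^+ x)) <->
             (exists x, right_coset H2 a2 (f * u ^+ x))) ->
  d1 = d2.
Proof.
move=> sub1 sub2 Hd1 Hd2 k0 Hk1 Hk2 H12.
have [||gT [rho [Q [rho_surj HQ]]]] :=
  @finite_quotient F bool (fun b => if b then H1 else H2).
- by case.
- by case; [exact: has_index_finite Hd1|exact: has_index_finite Hd2].
have /= Q1 := HQ true; have /= Q2 := HQ false.
have surj y : exists w, rho w = y.
  by have [w _ <-] : range rho y; [rewrite rho_surj | exists w].
have N (b : bool) a :
    (forall m, conj_set (if b then H1 else H2) a (u ^+ m) <-> k %| m) ->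
    #|[pred z | `[< exists x, right_coset [set` Q b] (rho a) (z * rho u ^+ x) >]]| =
      (k * #|Q b|)%N.
  move=> Hk; apply: card_cosets_orbits => // m; rewrite -Hk !conj_setP HQ /=.
  by rewrite !gmulfM multiplicativeV multiplicativeX.
have Qc b a f x : right_coset [set` Q b] (rho a) (rho f * rho u ^+ x) <->
    right_coset (if b then H1 else H2) a (f * u ^+ x).
  by rewrite !right_cosetP HQ /= !gmulfM multiplicativeV multiplicativeX.
have Q12 : #|Q true| = #|Q false|.
  apply/eqP; rewrite -(eqn_pmul2l k0) -(N true _ Hk1) -(N false _ Hk2).
  apply/eqP/eq_card => z.
  have [f <-] := surj z; rewrite !inE; apply: asbool_equiv_eq.
  split=> -[x /Qc Hx].
    by have [y Hy] := (H12 f).1 (ex_intro _ x Hx); exists y; apply/Qc.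
  by have [y Hy] := (H12 f).2 (ex_intro _ x Hx); exists y; apply/Qc.
have -> : d1 = #|[set: gT]%SET : Q true|.
  by apply: has_index_inj Hd1 _; rewrite Q1; exact: has_index_quotient.
have -> : d2 = #|[set: gT]%SET : Q false|.
  by apply: has_index_inj Hd2 _; rewrite Q2; exact: has_index_quotient.
by rewrite -!divgS ?finset.subsetT // Q12.
Qed.

(** * Coset partitions *)

Lemma iter_transition (F : groupType) (H : set F) w (c : right_cosets H) n :
  val (iter n (@transition F H w) c) = [set y * w ^+ n | y in val c].
Proof.
elim: n => [|n IHn] /=.
  apply/seteqP; split=> y /=; first by exists y; rewrite ?mulg1.
  by case=> z cz <-; rewrite mulg1.
rewrite IHn; apply/seteqP; split=> y /=.
  by case=> _ [z cz <-] <-; exists z => //; rewrite expgSr mulgA.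
by case=> z cz <-; exists (z * w ^+ n); [exists z|rewrite expgSr mulgA].
Qed.

(** A [d]-cycle on [d] cosets runs through all of them, so no positive power of [w] below the [d]-th
    fixes any coset. *)
Lemma full_cycle_orbit (F : groupType) (H : set F) d w a :
  subgroup H -> has_index H d -> is_cycle d (@transition F H w) ->
  forall m, 0 < m -> conj_set H a (w ^+ m) -> d <= m.
Proof.
move=> subH Hd [c [c_inj cd _]] m m0 Hm; rewrite leqNgt; apply/negP => md.
pose t := @transition F H w; pose f n := val (iter n t c).
have f_inj : {in `I_d &, injective f}.
  by move=> x y; rewrite !inE /= => xd yd /val_inj; exact: c_inj.
have fE : [set f x | x in `I_d] = right_cosets H.
  apply: contrapT => nE.
  have [_ [b _ <-] nb] : exists2 C, right_cosets H C & ~ [set f x | x in `I_d] C.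
    apply: contrapT => nC; apply: nE; apply/seteqP; split=> C.
      by case=> x _ <-; exact: set_valP.
    by move=> HC; apply: contrapT => nI; apply: nC; exists C.
  (* A coset missed by the cycle, placed at position [d], would make [d.+1] distinct cosets. *)
  pose g x := if x == d then right_coset H b else f x.
  suff : d.+1 <= d by rewrite ltnn.
  rewrite -card_le_II -(card_le_eqr Hd).
  have g_inj : {in `I_d.+1 &, injective g}.
    move=> x y; rewrite !inE /= /g !ltnS.
    case: eqVneq => [->|xd]; case: eqVneq => [->|yd] // xl yl E.
    - by case: nb; exists y => //=; rewrite ltn_neqAle yd.
    - by case: nb; exists x => //=; rewrite ltn_neqAle xd.
    - by apply: f_inj E; rewrite inE /= ltn_neqAle ?xd ?yd.
  rewrite -(card_le_eql (inj_card_eq g_inj)); apply: subset_card_le.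
  move=> _ [x _ <-]; rewrite /g; case: ifP => _; first by exists b.
  exact: set_valP.
have [n nd fn] : [set f x | x in `I_d] (right_coset H a) by rewrite fE; exists a.
(* [c] is the coset of [a * w ^- n]. As [w ^+ m] commutes with [w ^+ n], it fixes [c] too, so the
   iterates [m] and 0 coincide. *)
have cP y : val c y <-> right_coset H a (y * w ^+ n).
  rewrite -fn /f iter_transition; split=> [cy|]; first by exists y.
  by case=> z cz /mulIg <-.
have d0 := leq_ltn_trans (leq0n m) md.
suff /(c_inj m 0 md d0) m_eq0 : iter m t c = iter 0 t c by rewrite m_eq0 in m0.
apply: val_inj; rewrite iter_transition; apply/seteqP; split=> y /=.
  case=> z /cP Hz <-; apply/cP; rewrite -mulgA -expgnDr addnC expgnDr mulgA.
  exact/right_coset_conj.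
move=> /cP Hy; exists (y * w ^- m); last by rewrite mulgVK.
apply/cP/(right_coset_conj _ subH Hm).
by rewrite -mulgA -expgnDr addnC expgnDr mulgA mulgVK.
Qed.

Section Partition.
Variables (F : groupType) (s : nat) (H : 'I_s -> set F) (alpha : 'I_s -> F).
Variable d : 'I_s -> nat.
Hypothesis partH : coset_partition H alpha.
Hypothesis idxH : forall i, has_index (H i) (d i).

Let C i := right_coset (H i) (alpha i).
Let o i u := o_star H alpha i u.

Let subH i : subgroup (H i).
Proof. by case: partH. Qed.

Let disjC i j y : C i y -> C j y -> i = j.
Proof. by case: partH => _ + _ => /(_ i j I I) tI Ciy Cjy; apply: tI; exists y. Qed.

Let coverC y : exists i, C i y.
Proof.
by case: partH => _ _ /seteqP[_ /(_ y I)[i _ Ciy]]; exists i.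
Qed.

Let C_alpha i : C i (alpha i).
Proof. by apply/right_cosetP => //; rewrite mulgV; exact: subgroup1. Qed.

Lemma o_starP i u : 0 < o i u <= d i /\
  forall m, conj_set (H i) (alpha i) (u ^+ m) <-> o i u %| m.
Proof.
by apply: least_power_inP; [exact: subgroup_conj|exact: has_index_conj].
Qed.

Lemma max_order_repeats f u M p i0 x0 :
  (forall i, o i u <= M) -> o i0 u = M -> C i0 (f * u ^+ x0) -> 1 < M ->
  (forall q, prime q -> q %| M -> p <= q) ->
  p <= #|[pred i | (o i u == M) && `[< exists x, C i (f * u ^+ x) >]]|.
Proof.
move=> oM oi0 Ci0 M1 pM.
pose phi i x := `[< C i (f * u ^+ x) >].
apply: (@leq_trans #|[pred i | (o i u == M) && [exists x : 'I_M, phi i x]]|).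
  apply: maximal_modulus_repeats => //.
  - by move=> i; have [/andP[-> _] _] := o_starP i u; rewrite oM.
  - by move=> x; have [i Ci] := coverC (f * u ^+ x); exists i; apply/asboolP.
  - by move=> i j x /asboolP Ci /asboolP; exact: disjC.
  - move=> i x y /asboolP Ci; have [_ oP] := o_starP i u.
    by apply/asboolP/eqP; have := right_coset_expg y (subH i) oP Ci; case.
  - by exists i0, x0; split=> //; apply/asboolP.
apply: subset_leq_card; apply/fintype.subsetP => i; rewrite !inE.
case/andP=> -> /existsP[x /asboolP Cx].
by apply/asboolP; exists (x : nat).
Qed.

(** A left coset of the powers of [u] that meets one cell of order [k] meets at least [p] of them,
    hence all, since there are at most [p]. So any two such cells meet the same left cosets. *)
Lemma eq_index_max_order u k p i j :
  (forall i, o i u <= k) -> 1 < k ->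
  (forall q, prime q -> q %| k -> p <= q) ->
  #|[pred i | o i u == k]| <= p -> o i u = k -> o j u = k -> d i = d j.
Proof.
move=> ok k1 pk cp oi oj.
suff W i' j' f : o i' u = k -> o j' u = k ->
    (exists x, C i' (f * u ^+ x)) -> exists x, C j' (f * u ^+ x).
  apply: (eq_index_orbits (subH i) (subH j) (idxH i) (idxH j) (ltnW k1)).
  - by rewrite -oi; have [] := o_starP i u.
  - by rewrite -oj; have [] := o_starP j u.
  - by move=> f; split; exact: W.
move=> oi' oj' [x Cx]; have := max_order_repeats ok oi' Cx k1 pk.
set A := [pred i | _]; move=> pA.
have sA : A \subset [pred i | o i u == k].
  by apply/fintype.subsetP => l; rewrite !inE => /andP[].
have [_ +] := subset_leqif_card sA.
have -> : (#|A| == #|[pred i | o i u == k]|).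
  by rewrite eqn_leq (leq_trans cp pA) subset_leq_card.
move=> /esym/fintype.subsetP/(_ j'); rewrite !inE oj' eqxx /= => /(_ isT).
by move/asboolP.
Qed.

(** * The three sufficient conditions *)

Lemma cycle_condition_multiplicity : (forall i, 1 < d i) ->
  cycle_condition H d -> has_multiplicity d.
Proof.
move=> d1 [d_le [l [ls [_ [[w _ <-] w_cycle]]]]].
have odi i : o i w <= d i by have [/andP[]] := o_starP i w.
have ol : o l w = d l.
  apply/eqP; rewrite eqn_leq odi /=; have [/andP[ol0 _] olP] := o_starP l w.
  apply: (full_cycle_orbit (subH l) (idxH l) w_cycle ol0).
  exact/olP.
have dl i : d i <= d l by apply: d_le; rewrite -ltnS ls.
have Cl : C l (alpha l * w ^+ 0) by rewrite mulg1.
(* Every prime is at least 2, so this bound always yields a second index of maximal order. *)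
have := max_order_repeats (p := 2) (fun i => leq_trans (odi i) (dl i)) ol Cl (d1 l).
case/(_ _)/card_gt1P => [q /prime_gt1 //|i [j [+ + ij]]].
have E i' : o i' w == d l -> d i' = d l.
  by move=> /eqP oi'; apply/eqP; rewrite eqn_leq dl -oi' odi.
by rewrite !inE => /andP[/E di _] /andP[/E dj _]; exists i, j; rewrite di dj.
Qed.

Lemma card_large_index k r : nondecreasing_indices d -> d_lt d (s - r) k ->
  #|[pred i : 'I_s | k <= d i]| <= r.
Proof.
move=> d_le [i [isr dik]].
(* Ordinals start at 0, so [i] is the last of the first [s - r] positions and larger indices can
   only occur from position [s - r] on. *)
apply: (@leq_trans #|[pred j : 'I_s | s - r <= j]|).
  apply: subset_leq_card; apply/fintype.subsetP => j; rewrite !inE -isr => kj.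
  by rewrite ltnNge; apply: contraTN dik => /d_le ji; rewrite -leqNgt (leq_trans kj).
rewrite -sum1_card; under eq_bigl do rewrite inE.
rewrite -(big_geq_mkord (s - r) s xpredT (fun=> 1%N)) sum_nat_const_nat muln1.
by rewrite leq_subLR addnC -leq_subLR.
Qed.

Lemma order_condition_multiplicity :
  order_condition H alpha d -> has_multiplicity d.
Proof.
move=> [d_le [k [p [u [[_ ok] [p_prime pk p_min] c2 cases]]]]].
set c := #|_| in c2 cases.
have oi i : o i u <= k by rewrite -ok; exact: (leq_bigmax i).
have [i [j [+ + ij]]] := card_gt1P c2; rewrite !inE => /eqP oiu /eqP oju.
have k0 : 0 < k by rewrite -oiu; have [/andP[]] := o_starP i u.
have k1 : 1 < k := leq_trans (prime_gt1 p_prime) (dvdn_leq k0 pk).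
suff cp : c <= p by exists i, j; split=> //; exact: (eq_index_max_order oi k1 p_min cp).
have p2 := prime_gt1 p_prime.
have cr r : d_lt d (s - r) k -> c <= r.
  move=> /(card_large_index d_le); apply: leq_trans; apply: subset_leq_card.
  by apply/fintype.subsetP => l; rewrite !inE => /eqP <-; have [/andP[]] := o_starP l u.
(* Each case gives [c <= p]: the bound on [c] from [cr] is at most [p], or [c = p], or, for [c >= 4]
   in (c) and [c >= r + 1] in (d), that bound is contradicted. *)
case: cases => [[_ /cr]|[_ /cr c3]|[_ /cr c3 p2E]|[r [_ _ /cr c_r]]].
- by move/leq_trans; apply.
- exact: leq_trans.
- by case=> [->|/leq_trans/(_ c3)] //.
- case=> [|->|] //; first exact: leq_trans.
  by rewrite addn1 => /leq_trans/(_ c_r); rewrite ltnn.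
Qed.

(** [w] maps every cell other than the [j]-th and [k]-th onto itself, and no point of the [j]-th
    cell back into it. So it carries the [j]-th cell into the [k]-th, and quotients of image points
    give the inclusion. *)
Lemma unstable_coset j k w :
  (forall i, i != j -> i != k -> conj_set (H i) (alpha i) w) ->
  ~ conj_set (H j) (alpha j) w ->
  [/\ j != k, H j `<=` H k & ~ conj_set (H k) (alpha k) w].
Proof.
move=> Aw nAj.
have Ckw y : C j y -> C k (y * w).
  move=> Cy; have [i Ci] := coverC (y * w).
  have [ij|ij] := eqVneq i j.
    by case: nAj; apply: conj_right_coset Cy _ => //; rewrite -ij.
  have [<- //|ik] := eqVneq i k.
  have /(right_coset_conj _ (subH i)) E := Aw i ij ik.
  by case/eqP: ij; apply: disjC Cy; apply/E.
have nAk : ~ conj_set (H k) (alpha k) w.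
  move=> Ak; have Cka := (right_coset_conj _ (subH k) Ak).1 (Ckw _ (C_alpha j)).
  by apply: nAj; have -> : j = k by apply: disjC Cka.
split=> //.
  apply/eqP => jk; apply: nAj; apply: (conj_right_coset (subH j) (C_alpha j)).
  by have := Ckw _ (C_alpha j); rewrite -jk.
move=> h Hh; have Cah : C j (h * alpha j) by exists h.
have /right_cosetP Hk1 := Ckw _ (C_alpha j).
have /right_cosetP Hk2 := Ckw _ Cah.
rewrite -(mulgK (alpha j * w * (alpha k)^-1) h) !mulgA.
by apply: subgroupF => //; move: Hk2; rewrite !mulgA.
Qed.

Lemma intersection_condition_multiplicity :
  intersection_condition H alpha d -> has_multiplicity d.
Proof.
case=> j [k] /=; set A := fun i => conj_set (H i) (alpha i).
set B := \bigcap_(i in [set i | _]) _ => cond.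
(* Such a [w] allows [unstable_coset] in both directions, giving [H j = H k] with distinct
   indices. *)
suff [w Bw nw] : exists2 w, B w & ~ A j w \/ ~ A k w.
  have W j' k' : (forall i, i != j' -> i != k' -> A i w) -> ~ A j' w ->
      has_multiplicity d.
    move=> Aw nAj; have [jk Hjk nAk] := unstable_coset Aw nAj.
    have [|_ Hkj _] := unstable_coset (j := k') (k := j') _ nAk.
      by move=> i *; exact: Aw.
    exists j', k'; split=> //; apply: has_index_inj (idxH j') _.
    by have -> : H j' = H k' by apply/seteqP.
  by case: nw; [apply: (W j k)|apply: (W k j)] => i ? ?; apply: Bw.
(* Otherwise [B] lies in both remaining conjugates: it equals the full intersection, and its index
   is divisible by [d j] and [d k], against either alternative. *)
apply: contrapT => nB.
have BA i : i = j \/ i = k -> B `<=` A i.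
  move=> ijk w Bw; apply: contrapT => nA; apply: nB; exists w => //.
  by case: ijk nA => -> nA; [left|right].
have subA i : subgroup (A i) by exact: subgroup_conj.
case: cond => [[_ nBA]|[m [Bm /negP]]].
  apply: nBA => w Bw i _; have [ij|ij] := eqVneq i j; first exact: (BA i (or_introl ij)).
  have [ik|ik] := eqVneq i k; first exact: (BA i (or_intror ik)).
  by apply: Bw.
apply; rewrite dvdn_lcm.
have subB : subgroup B.
  apply: subgroup_intro => [i _|x y Bx By i Di]; first exact: (subgroup1 (subA i)).
  exact: (subgroupF (subA i) (Bx i Di) (By i Di)).
have dvd i : i = j \/ i = k -> d i %| m.
  move=> ijk; apply: index_dvd subB (subA i) (BA i ijk) Bm _.
  exact: has_index_conj.
by rewrite !dvd; [|right|left].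
Qed.

End Partition.

Theorem theorem6 (n : nat) (F : groupType) (x : 'I_n -> F)
    (hF : free_basis x)
    (G : groupType) (N : set F) (pi : {multiplicative F -> G})
    (hpi : range pi = setT) (hN : pi @^-1` [set 1] = N)
    (s : nat) (K : 'I_s -> set G) (g : 'I_s -> G) (d : 'I_s -> nat)
    (hK : coset_partition K g)
    (hd : forall i, has_index (K i) (d i)) (hd1 : forall i, (1 < d i)%N)
    (H : 'I_s -> set F) (hH : forall i, H i = pi @^-1` K i)
    (alpha : 'I_s -> F) (halpha : forall i, pi (alpha i) = g i) :
  (coset_partition H alpha /\ forall i, has_index (H i) (d i)) /\
  ([\/ cycle_condition H d,
       order_condition H alpha d
     | intersection_condition H alpha d] ->
   has_multiplicity d).
Proof.
have [subK disjK coverK] := hK.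
have cosetE i : right_coset (H i) (alpha i) = pi @^-1` right_coset (K i) (g i).
  by rewrite hH right_coset_preimage // halpha.
have partH : coset_partition H alpha.
  split=> [i|i j _ _|]; first by rewrite hH; exact: subgroup_preimage.
    by rewrite !cosetE => -[y [Ki Kj]]; apply: disjK => //; exists (pi y).
  apply/seteqP; split=> // y _.
  have : (\bigcup_i right_coset (K i) (g i)) (pi y) by rewrite coverK.
  by case=> i _ Ki; exists i => //; rewrite cosetE.
have idxH i : has_index (H i) (d i) by rewrite hH; exact: has_index_preimage.
split=> // -[].
- exact: cycle_condition_multiplicity partH idxH hd1.
- exact: order_condition_multiplicity partH idxH.
- exact: intersection_condition_multiplicity partH idxH.
Qed.
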